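(* Let $X$ and $Y$ be complex topological vector spaces, and assume that $\Gamma\subset\mathcal{B}(X)$ and $\Gamma_1\subset\mathcal{B}(Y)$ are similar. Then $\Gamma$ is strictly disk transitive in $X$ if and only if $\Gamma_1$ is strictly disk transitive in $Y$.
   Context: $\mathcal{B}(X)$ is the set of all continuous linear operators on $X$, and $\mathbb{D}=\{\alpha\in\mathbb{C}:|\alpha|\le 1\}$. $\Gamma$ and $\Gamma_1$ are called similar if there exists a continuous linear operator $\phi:X\to Y$ that is a homeomorphism and such that for all $T\in\Gamma$ there exists $S\in\Gamma_1$ satisfying $S\circ\phi=\phi\circ T$. $\Gamma$ is strictly disk transitive if for each pair of nonzero elements $x,y\in X$ there exist $\alpha\in\mathbb{D}$ and $T\in\Gamma$ such that $\alpha Tx=y$ (similarly for $\Gamma_1$ on $Y$).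
   Formalization: The ''if'' direction fails for one-directional similarity (X=Y=ℂ, φ=id, Γ={0}, Γ₁=B(ℂ)); here ''Γ strictly disk transitive implies Γ₁ is'' is proved as stated, and the equivalence is proved assuming also that Γ₁ is similar to Γ. *)

(* Defs.v *)
From HB Require Import structures.
From mathcomp Require Import all_boot all_order all_algebra.
From mathcomp Require Export complex.
From mathcomp Require Import boolp classical_sets functions.
From mathcomp Require Import reals topology normedtype.

Set Implicit Arguments.
Unset Strict Implicit.
Unset Printing Implicit Defensive.

Import Order.TTheory GRing.Theory Num.Theory.
Import numFieldTopology.Exports.
Import numFieldNormedType.Exports.

Local Open Scope classical_set_scope.
Local Open Scope ring_scope.
Local Open Scope complex_scope.

(* A complex topological vector space is a topologicalLmodType over R[i];
   the library's tvsType is not used because it also requires local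
   convexity. *)

Definition continuous_linear (R : realType) (X Y : topologicalLmodType R[i])
    (f : X -> Y) : Prop :=
  linear f /\ continuous f.

Definition continuous_operators (R : realType) (X : topologicalLmodType R[i]) :
    set (X -> X) :=
  [set T | continuous_linear T].
Arguments continuous_operators {R} X.

Definition homeomorphism (S T : topologicalType) (f : S -> T) : Prop :=
  continuous f /\
  exists g : T -> S, [/\ cancel f g, cancel g f & continuous g].

Definition unit_disk (R : realType) : set R[i] := [set a | `|a| <= 1].

(* As a relation this is not symmetric: nothing is required of the members
   of G1 that are not conjugate to a member of G. *)
Definition similar_operators (R : realType) (X Y : topologicalLmodType R[i])
    (G : set (X -> X)) (G1 : set (Y -> Y)) : Prop :=
  exists phi : X -> Y,
    [/\ continuous_linear phi,
        homeomorphism phi &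
        forall T, G T -> exists2 S, G1 S & S \o phi = phi \o T].

Definition strictly_disk_transitive (R : realType)
    (X : topologicalLmodType R[i]) (G : set (X -> X)) : Prop :=
  forall x y : X, x != 0 -> y != 0 ->
    exists a : R[i], exists T : X -> X,
      [/\ unit_disk a, G T & a *: T x = y].

(* Main.v *)
(* If y = phi x and y' = phi x', with phi the linear homeomorphism intertwining
   T and S, then phi carries [a *: T x = x'] to [a *: S y = y']. *)
Require Import Defs.
From mathcomp Require Import all_boot all_order all_algebra.
From mathcomp Require Import boolp classical_sets functions.
From mathcomp Require Import reals topology normedtype.

Local Open Scope classical_set_scope.
Local Open Scope ring_scope.
Local Open Scope complex_scope.

(** Pull nonzero [y], [y'] back along [phi], solve there with [a] and [T], and push forward: the
    conjugate [S] works with the same [a]. Since similarity is directed (an empty [G] is similar to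
    any [G1]), one similarity gives one implication; the equivalence applies
    [similar_strictly_disk_transitive] both ways. *)

Lemma linear_fun0 (K : nzRingType) (U V : lmodType K) (f : U -> V) :
  linear f -> f 0 = 0.
Proof.
move=> f_lin; have := f_lin (-1) 0 0.
by rewrite !GRing.scaleN1r GRing.oppr0 GRing.addr0 GRing.addNr.
Qed.

Lemma similar_strictly_disk_transitive (R : realType)
    (X Y : topologicalLmodType R[i]) (G : set (X -> X)) (G1 : set (Y -> Y)) :
  similar_operators G G1 ->
  strictly_disk_transitive G -> strictly_disk_transitive G1.
Proof.
move=> [phi [[phi_lin _] [_ [psi [_ psiK _]]] conj]] G_trans y y' y0 y'0.
have phi0 : phi 0 = 0 by exact: linear_fun0.
(* Linearity of [psi] is avoided: [psi z = 0] forces [z = phi 0 = 0]. *)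
have psi_neq0 z : z != 0 -> psi z != 0.
  by apply: contra_neq => psi_z; rewrite -(psiK z) psi_z.
have [a [T [a_disk GT aT]]] := G_trans _ _ (psi_neq0 _ y0) (psi_neq0 _ y'0).
have [S G1S S_phi] := conj T GT.
exists a, S; split=> //.
rewrite -[y in S y]psiK -[S (phi _)]/((S \o phi) _) S_phi -[RHS]psiK -aT /=.
(* [linear] is the law for [a *: u + v], so a zero summand is added to extract the scalar. *)
by rewrite -[a *: T _]GRing.addr0 phi_lin phi0 GRing.addr0.
Qed.

Theorem proposition3p11 (R : realType) (X Y : topologicalLmodType R[i])
    (G : set (X -> X)) (G1 : set (Y -> Y))
    (hG : G `<=` continuous_operators X)
    (hG1 : G1 `<=` continuous_operators Y)
    (hsim : similar_operators G G1) :
  (strictly_disk_transitive G -> strictly_disk_transitive G1) /\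
  (similar_operators G1 G ->
    (strictly_disk_transitive G <-> strictly_disk_transitive G1)).
Proof.
split=> [|hsim']; first exact: similar_strictly_disk_transitive.
by split; apply: similar_strictly_disk_transitive.
Qed.
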